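(* Let $X$ be a real Banach space and let $X^*$ be its topological dual. Let $T:X\rightrightarrows X^*$ be a lower semicontinuous operator with convex domain $D(T)$. Let $D\subseteq D(T)$ be self segment-dense in $D(T)$ and assume that $T$ is locally pseudomonotone on $D$. Assume further that for all $x,y\in D(T)$ with $x\neq y$, all $z\in[x,y]\cap(D(T)\setminus D)$ and all $z^*\in T(z)$ one has $\langle z^*,y-x\rangle\neq0$. Then $T$ is pseudomonotone.
   Context: $\langle x^*,x\rangle = x^*(x)$ for $x^*\in X^*$, $x\in X$. For $x,y\in X$: $[x,y]=\{x+t(y-x):t\in[0,1]\}$. A set-valued operator $T:X\rightrightarrows X^*$ assigns to each $x\in X$ a (possibly empty) set $T(x)\subseteq X^*$; its domain is $D(T)=\{x:T(x)\ne\emptyset\}$ and its graph is $G(T)=\{(x,x^* ):x^*\in T(x)\}$. The restriction $T|_A$ agrees with $T$ on $A$ and is empty-valued elsewhere. $T$ is lower semicontinuous if for every $x\in D(T)$ and every (norm-)open $N\subseteq X^*$ with $T(x)\cap N\ne\emptyset$ there is a neighborhood $M$ of $x$ such that $T(y)\cap N\neq\emptyset$ for all $y\in M\cap D(T)$. $P\subseteq S$ is dense in $S$ if $S\subseteq \mathrm{cl}(P)$. For $U\subseteq V\subseteq X$ with $V$ convex, $U$ is self segment-dense in $V$ if $U$ is dense in $V$ and for all $x,y\in U$ the set $[x,y]\cap U$ is dense in $[x,y]$. $T$ is pseudomonotone if for all $(x,x^* ),(y,y^* )\in G(T)$: $\langle x^*,y-x\rangle\ge0\Rightarrow\langle y^*,y-x\rangle\ge0$.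 For $D\subseteq D(T)$, $T$ is locally pseudomonotone on $D$ if every $x\in D$ has an open neighborhood $U_x$ such that $T|_{U_x\cap D}$ is pseudomonotone. *)

(* Defs.v *)
From HB Require Import structures.
From mathcomp Require Import all_boot all_order all_algebra.
From mathcomp Require Import all_classical all_reals all_analysis.

Set Implicit Arguments.
Unset Strict Implicit.
Unset Printing Implicit Defensive.

Import Order.TTheory GRing.Theory Num.Theory.
Import numFieldNormedType.Exports.

Local Open Scope classical_set_scope.
Local Open Scope ring_scope.

Section Dual.
Context {R : realType} (X : normedModType R).

Definition continuous_linear : {pred X -> R^o} :=
  fun f => `[< linear f /\ continuous f >].

Lemma continuous_linear_submod_closed : submod_closed continuous_linear.
Proof.
split=> [|a f g].
- apply/asboolP; split=> [a u v|x]; last exact: cvg_cst.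
  by rewrite /= scaler0 addr0.
- move=> /asboolP[lf cf] /asboolP[lg cg]; apply/asboolP; split.
    move=> b u v.
    change (a *: f (b *: u + v) + g (b *: u + v) =
            b *: (a *: f u + g u) + (a *: f v + g v)).
    have -> : f (b *: u + v) = b *: f u + f v := lf b u v.
    have -> : g (b *: u + v) = b *: g u + g v := lg b u v.
    by rewrite !scalerDr addrACA !scalerA (mulrC b a).
  move=> x; apply: (@cvgD R R^o); last exact: cg.
  by apply: (@cvgZr _ R^o); exact: cf.
Qed.

HB.instance Definition _ := GRing.isSubmodClosed.Build R (X -> R^o)
  continuous_linear continuous_linear_submod_closed.

Record dual : Type := Dual {
  dual_val :> X -> R^o;
  dual_valP : dual_val \in continuous_linear }.

HB.instance Definition _ := [isSub for dual_val].
HB.instance Definition _ := [Choice of dual by <:].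
HB.instance Definition _ := [SubChoice_isSubLmodule of dual by <:].

Implicit Types (f g : dual).

Lemma dual_linear f : linear f.
Proof. by have /asboolP[] := dual_valP f. Qed.

Lemma dual_continuous f : continuous (f : X -> R^o).
Proof. by have /asboolP[] := dual_valP f. Qed.

HB.instance Definition _ f :=
  GRing.isLinear.Build R X R^o *:%R (dual_val f) (dual_linear f).

Definition dual_norm f : R := sup [set `|f x| | x in [set x : X | `|x| <= 1]].

Lemma dual_has_sup f :
  has_sup [set `|f x| | x in [set x : X | `|x| <= 1]].
Proof.
split; first by exists `|f 0|, 0 => //=; rewrite normr0.
have /linear_bounded_continuous/bounded_funP/(_ 1)[M fM] := @dual_continuous f.
by exists M => _ [x /= x1 <-]; exact: fM.
Qed.

Lemma le_dual_norm f (x : X) : `|x| <= 1 -> `|f x| <= dual_norm f.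
Proof. by move=> x1; apply: (sup_ubound (dual_has_sup f).2); exists x. Qed.

Lemma dual_norm_le f (M : R) :
  (forall x : X, `|x| <= 1 -> `|f x| <= M) -> dual_norm f <= M.
Proof.
move=> fM; apply: (sup_le_ub (dual_has_sup f).1).
by move=> _ [x /= x1 <-]; exact: fM.
Qed.

Lemma dual_norm_ge0 f : 0 <= dual_norm f.
Proof.
by apply: (le_trans (normr_ge0 (f 0))); apply: le_dual_norm; rewrite normr0.
Qed.

Lemma ler_dual_normD f g : dual_norm (f + g) <= dual_norm f + dual_norm g.
Proof.
apply: dual_norm_le => x x1.
by apply: (le_trans (ler_normD (f x) (g x))); apply: lerD; exact: le_dual_norm.
Qed.

Lemma dual_normZ_le (a : R) f : dual_norm (a *: f) <= `|a| * dual_norm f.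
Proof.
apply: dual_norm_le => x x1; rewrite [`|_|](normrM a (f x)).
by apply: ler_wpM2l => //; exact: le_dual_norm.
Qed.

Lemma dual_normZ (a : R) f : dual_norm (a *: f) = `|a| * dual_norm f.
Proof.
apply/eqP; rewrite eq_le dual_normZ_le /=.
have [->|a0] := eqVneq a 0; first by rewrite normr0 mul0r dual_norm_ge0.
rewrite -ler_pdivlMl ?normr_gt0 // -normfV.
by have := dual_normZ_le a^-1 (a *: f); rewrite scalerA mulVf // scale1r.
Qed.

Lemma dual_norm_eq0 f : dual_norm f = 0 -> f = 0.
Proof.
move=> f0; apply/val_inj/funext => x /=; apply/eqP.
have [->|x0] := eqVneq x 0; first by rewrite linear0.
have : `|f (`|x|^-1 *: x)| <= 0.
  by rewrite -f0; apply: le_dual_norm; rewrite normrZ normfV normr_id mulVf ?normr_eq0.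
by rewrite normr_le0 linearZ /= scaler_eq0 invr_eq0 normr_eq0 (negbTE x0).
Qed.

HB.instance Definition _ := Lmodule_isNormed.Build R dual
  ler_dual_normD dual_normZ dual_norm_eq0.

End Dual.

Section Operators.
Context {R : realType} {X : normedModType R}.
Implicit Types (T : X -> set (dual X)) (A D P S U V : set X).

Definition pairing (xs : dual X) (x : X) : R := xs x.

Definition segment (x y : X) : set X :=
  [set x + t *: (y - x) | t in `[(0 : R), 1]].

Definition domain T : set X := [set x | T x !=set0].

Definition graph T : set (X * dual X) := [set p | T p.1 p.2].

Definition restriction T A : X -> set (dual X) :=
  fun x => [set xs | A x /\ T x xs].

(* [open N] refers to the topology of the dual norm. *)
Definition lower_semicontinuous_op T : Prop :=
  forall x, domain T x -> forall N : set (dual X), open N ->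
    T x `&` N !=set0 ->
    exists2 M : set X, nbhs x M &
      forall y, (M `&` domain T) y -> T y `&` N !=set0.

(* Relative density; the library's [dense] is density in the whole space. *)
Definition dense_in P S : Prop := P `<=` S /\ S `<=` closure P.

Definition self_segment_dense U V : Prop :=
  dense_in U V /\
  forall x y, U x -> U y -> dense_in (segment x y `&` U) (segment x y).

Definition pseudomonotone T : Prop :=
  forall x xs y ys, graph T (x, xs) -> graph T (y, ys) ->
    0 <= pairing xs (y - x) -> 0 <= pairing ys (y - x).

Definition locally_pseudomonotone T D : Prop :=
  forall x, D x -> exists U : set X,
    [/\ open U, U x & pseudomonotone (restriction T (U `&` D))].

End Operators.

(* Main.v *)
(* If z lies in the domain but not in D and z* is in T(z), the hypothesis says
   that z* vanishes nowhere on dom T - z except at 0.  When z is interior to a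
   segment [x, y] of dom T, a point v of dom T off the line xy could be joined
   to x or to y by a segment crossing the hyperplane z + ker z* away from z; so
   dom T lies on the line xy.  Hence D is always dense in [x, y], either because
   the open segment is contained in D or because D is dense in dom T.
   Pairing with y - x reduces the claim to a set-valued F on [0, 1].  If F 0
   has an element >= 0 and F 1 an element < 0, let s be the supremum of 0 and of
   the points where F has no negative value: F s has an element >= 0, whereas F
   has a negative value everywhere on (s, 1].  This contradicts local
   pseudomonotonicity at s, or, if s is outside the dense set, at a nearby
   point to the right of s, where F still has a positive value by lower
   semicontinuity. *)
Require Import Defs.
From HB Require Import structures.
From mathcomp Require Import all_boot all_order all_algebra.
From mathcomp Require Import all_classical all_reals all_analysis.
From mathcomp Require Import lra.

Import Order.TTheory GRing.Theory Num.Theory.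
Import numFieldNormedType.Exports.

Local Open Scope classical_set_scope.
Local Open Scope ring_scope.

(** In use, [F t] collects the pairings with y - x of the elements of T(x + t(y - x)), and [E] the
    parameters of the points of [D]. *)
Lemma lsc_local_sign_propagation (R : realType) (F : R -> set R) (E : set R)
    (a b : R)
    (F_nonempty : forall t, 0 <= t <= 1 -> F t !=set0)
    (F_lsc : forall t, 0 <= t <= 1 -> forall N : set R, open N ->
       F t `&` N !=set0 ->
       \forall u \near t, 0 <= u <= 1 -> F u `&` N !=set0)
    (E_dense : forall c d : R, 0 <= c -> c < d -> d <= 1 ->
       exists2 t, E t & c < t < d)
    (F_neq0 : forall t, 0 <= t <= 1 -> ~ E t -> ~ F t 0)
    (F_local : forall t, 0 <= t <= 1 -> E t -> exists2 V : set R, nbhs t V &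
       forall u v p q, V u -> V v -> E u -> E v -> 0 <= u -> u < v -> v <= 1 ->
         F u p -> F v q -> 0 <= p -> 0 <= q) :
  F 0 a -> F 1 b -> 0 <= a -> 0 <= b.
Proof.
move=> F0a F1b a_ge0; rewrite leNgt; apply/negP => b_lt0.
pose P := [set t : R | exists2 q, F t q & q < 0].
pose N := [set t : R | 0 <= t <= 1 /\ (t = 0 \/ ~ P t)].
have supN : has_sup N.
  by split; [exists 0; split; [lra|left]|exists 1 => t [/andP[]]].
have N0 : N 0 by split; [lra|left].
have s_ge0 : 0 <= sup N by exact: (sup_ubound supN.2) N0.
have s_le1 : sup N <= 1 by apply: (sup_le_ub supN.1) _ => t [/andP[]].
set s := sup N in s_ge0 s_le1 *.
have PN t : s < t -> t <= 1 -> P t.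
  move=> st t1; apply: contrapT => nPt.
  have : t <= s by apply: (sup_ubound supN.2) _; split; [lra|right].
  by rewrite leNgt st.
(* A negative value at [s] would persist near [s] by lower semicontinuity, yet [N] has points just
   left of [s]. The cap [s] in the minimum keeps them positive, so that the exception t = 0 does not
   apply. *)
have Ns : N s.
  apply: contrapT => nNs.
  have s01 : 0 <= s <= 1 by lra.
  have s_neq0 : s != 0 by apply/eqP => s0; apply: nNs; rewrite s0.
  have s_gt0 : 0 < s by rewrite lt_neqAle eq_sym s_neq0.
  have [q Fsq q_lt0] : P s.
    by apply: contrapT => nPs; apply: nNs; split => //; right.
  have [|e /= e0 He] := F_lsc s s01 [set r | r < 0] (@open_lt R 0).
    by exists q.
  have m0 : 0 < Num.min e s by rewrite lt_min e0.
  have [t Nt] := sup_adherent m0 supN.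
  rewrite -/s ltrBlDr -ltrBlDl lt_min => /andP[te ts].
  have t_le_s : t <= s by exact: (sup_ubound supN.2) Nt.
  case: Nt => t01 [t0|]; first by lra.
  have [|//|r [Ftr /= r0]] := He t; last by apply; exists r.
  by rewrite /= ger0_norm; lra.
have s_lt1 : s < 1.
  rewrite lt_neqAle s_le1 andbT; apply/eqP => s1.
  case: Ns => _ []; rewrite s1; first by lra.
  by apply; exists b.
have s01 : 0 <= s <= 1 by lra.
have [p Fsp p_ge0] : exists2 p, F s p & 0 <= p.
  case: Ns => _ [->|nPs]; first by exists a.
  have [p Fsp] := F_nonempty s s01; exists p => //.
  by rewrite leNgt; apply/negP => p0; apply: nPs; exists p.
(* [E] has a point [u] just right of [t], in the neighborhood given by [F_local]; there [F] has a
   negative value. *)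
have step t p' : s <= t -> t < 1 -> E t -> F t p' -> 0 <= p' -> False.
  move=> st t1 Et Ftp' p'0.
  have t01 : 0 <= t <= 1 by lra.
  have [V nV HV] := F_local t t01 Et.
  move: (nV) => [e /= e0 He].
  have m0 : 0 < Num.min e (1 - t) by rewrite lt_min e0; lra.
  have [|||u Eu /andP[tu]] := E_dense t (t + Num.min e (1 - t)).
  - by lra.
  - by lra.
  - by rewrite -lerBrDl ge_min lexx orbT.
  rewrite -ltrBlDl lt_min => /andP[ue u1].
  have [||q Fuq q0] := PN u; [by lra|by lra|].
  suff : 0 <= q by lra.
  apply: (HV t u p' q) => //; [exact: nbhs_singleton| |by lra|by lra].
  by apply: He; rewrite /= distrC gtr0_norm; lra.
have [Es|nEs] := pselect (E s); first exact: step Es Fsp p_ge0.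
(* Strict positivity is an open condition, so lower semicontinuity carries it to a point of [E]
   right of [s]. *)
have p_gt0 : 0 < p.
  rewrite lt_neqAle p_ge0 andbT; apply/eqP => p0.
  by apply: (F_neq0 s) => //; rewrite p0.
have [|e /= e0 He] := F_lsc s s01 [set r | 0 < r] (@open_gt R 0).
  by exists p.
have m0 : 0 < Num.min e (1 - s) by rewrite lt_min e0; lra.
have [|||u Eu /andP[su]] := E_dense s (s + Num.min e (1 - s)).
- by lra.
- by lra.
- by rewrite -lerBrDl ge_min lexx orbT.
rewrite -ltrBlDl lt_min => /andP[ue u1].
have [||r [Fur /= r0]] := He u; first by rewrite /= distrC gtr0_norm; lra.
  by lra.
by apply: (step u r) => //; lra.
Qed.

Lemma convex_set_line {R : realType} {X : lmodType R} {A : set X} {x y : X}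
    {t : R} :
  convex_set A -> A x -> A y -> 0 <= t <= 1 -> A (x + t *: (y - x)).
Proof.
move=> cA Ax Ay /andP[t0 t1].
have := cA y x (Itv01 t0 t1) (mem_set Ay) (mem_set Ax).
rewrite inE; congr (A _).
change (t *: y + (1 - t) *: x = x + t *: (y - x)).
by rewrite scalerBr scalerBl scale1r addrCA addrA addrC addrCA.
Qed.

Section dual_extra.
Context {R : realType} {X : normedModType R}.
Implicit Types (f : dual X) (A : set X).

Lemma ler_dual_norm_norm f (x : X) : `|f x| <= dual_norm f * `|x|.
Proof.
have [->|x0] := eqVneq x 0; first by rewrite linear0 !normr0 mulr0.
rewrite -ler_pdivrMr ?normr_gt0 //.
have <- : `|f (`|x|^-1 *: x)| = `|f x| / `|x|.
  by rewrite linearZ /= normrZ normfV normr_id mulrC.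
by apply: le_dual_norm; rewrite normrZ normfV normr_id mulVf ?normr_eq0.
Qed.

Lemma open_pairing_preimage (v : X) (N : set R) :
  open N -> open [set f : dual X | N (pairing f v)].
Proof.
move=> oN; rewrite openE => f /= Nf.
have /nbhs_ballP[e /= e0 He] : nbhs (pairing f v) N by exact: open_nbhs_nbhs.
(* Adding 1 keeps the radius meaningful when v = 0. *)
have k0 : 0 < `|v| + 1 by rewrite ltr_wpDl.
apply/nbhs_ballP; exists (e / (`|v| + 1)); first by rewrite /= divr_gt0.
move=> g; rewrite -ball_normE /= => fg; apply: He; rewrite -ball_normE /=.
apply: (le_lt_trans (ler_dual_norm_norm (f - g) v)).
rewrite (le_lt_trans _ (_ : `|f - g| * (`|v| + 1) < e)) //.
  by apply: ler_wpM2l; [exact: dual_norm_ge0|rewrite lerDl].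
by rewrite -ltr_pdivlMr.
Qed.

(** As f changes sign between x - w and v - w, the segment from x to v meets the hyperplane w + ker
    f, at parameter p / (p - q). The crossing point lies in [A], hence is w itself. *)
Lemma convex_nonvanishing_collinear A (w x v : X) f :
  convex_set A -> A x -> A v ->
  (forall u, A u -> u <> w -> f (u - w) <> 0) ->
  f (x - w) * f (v - w) < 0 ->
  f (x - w) *: (v - w) = f (v - w) *: (x - w).
Proof.
move=> cA Ax Av f_neq0; set p : R := f (x - w); set q : R := f (v - w) => pq0.
have d0 : p - q != 0.
  apply/eqP => d0; have := sqr_ge0 p.
  by have : p * (p - q) = 0 by [rewrite d0 mulr0]; nra.
pose t : R := p / (p - q).
have t01 : 0 <= t <= 1.
  have [d_gt0|d_lt0|/eqP] := ltrgt0P (p - q); last by rewrite (negbTE d0).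
    by rewrite /t divr_ge0 ?ler_pdivrMr //=; nra.
  by rewrite /t -mulrNN -invrN divr_ge0 ?ler_pdivrMr //=; nra.
have Au := convex_set_line cA Ax Av t01.
have uE : x + t *: (v - x) - w = (x - w) + t *: ((v - w) - (x - w)).
  by rewrite addrAC opprB addrA subrK.
have /eqP : x + t *: (v - x) - w = 0.
  apply/eqP; rewrite subr_eq0; apply/eqP; apply: contrapT => uw.
  apply: (f_neq0 _ Au uw).
  have -> : f (x + t *: (v - x) - w) = p + t * (q - p).
    rewrite uE linearD linearZ /=; congr (p + t * _).
    exact: linearB.
  by rewrite -(opprB p q) mulrN /t divfK // subrr.
rewrite uE; move: (x - w) (v - w) => a b /eqP /(congr1 (fun u => (p - q) *: u)).
rewrite scaler0 scalerDr scalerA /t mulrC divfK // => H.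
apply/eqP; rewrite -subr_eq0 -H; apply/eqP.
by rewrite scalerBr scalerBl [RHS]addrC addrA subrK.
Qed.

Lemma dense_in_convex_line A (D : set X) (x y : X) (c d : R) :
  convex_set A -> A x -> A y -> x <> y -> dense_in D A ->
  (forall w, A w -> ~ D w -> exists f : dual X,
     forall u, A u -> u <> w -> f (u - w) <> 0) ->
  0 <= c -> c < d -> d <= 1 ->
  exists2 t, D (x + t *: (y - x)) & c < t < d.
Proof.
move=> cA Ax Ay xy [DA AD] f_ex c0 cd d1.
pose m := (c + d) / 2; have m01 : 0 < m < 1 by rewrite /m; lra.
pose w := x + m *: (y - x).
have Aw : A w by apply: convex_set_line => //; lra.
have [Dw|nDw] := pselect (D w); first by exists m => //; rewrite /m; lra.
have [f f_neq0] := f_ex w Aw nDw.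
have xw : x - w = - m *: (y - x) by rewrite /w opprD addNKr scaleNr.
have yw : y - w = (1 - m) *: (y - x).
  by rewrite /w opprD addrA scalerBl scale1r.
have yx0 : y - x != 0 by rewrite subr_eq0 eq_sym; exact/eqP.
pose e : R := f (y - x).
have fx : f (x - w) = - m * e by rewrite xw linearZ.
have fy : f (y - w) = (1 - m) * e by rewrite yw linearZ.
have e0 : e <> 0.
  move=> e0; apply: (f_neq0 x) => //; last by rewrite fx e0 mulr0.
  move=> xE; move/eqP: xw; rewrite {1}xE subrr eq_sym scaler_eq0 (negbTE yx0).
  by rewrite orbF oppr_eq0 gt_eqF //; lra.
have collinear v : A v -> exists k, v - w = k *: (y - x).
  move=> Av; have [->|/eqP vw] := eqVneq v w.
    by exists 0; rewrite subrr scale0r.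
  have q0 := f_neq0 v Av vw; set q : R := f (v - w) in q0.
  exists (e^-1 * q); apply: (scalerI (a := e)); first exact/eqP.
  rewrite scalerA mulVKf; last exact/eqP.
  have qe0 : q * e <> 0 by apply/eqP; rewrite mulf_neq0 //; exact/eqP.
  (* f(x - w) has the sign of -e and f(y - w) that of e: the sign of [q * e] tells which endpoint
     lies across the hyperplane from v. *)
  have [qe|qe|//] := ltrgt0P (q * e).
  - have := @convex_nonvanishing_collinear _ _ _ _ _ cA Ax Av f_neq0.
    rewrite fx -/q xw scalerA [q * _]mulrC -!scalerA => H.
    apply: (scalerI (a := - m)); first by rewrite oppr_eq0 gt_eqF //; lra.
    by apply: H; nra.
  - have := @convex_nonvanishing_collinear _ _ _ _ _ cA Ay Av f_neq0.
    rewrite fy -/q yw scalerA [q * _]mulrC -!scalerA => H.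
    apply: (scalerI (a := 1 - m)); first by rewrite gt_eqF //; lra.
    by apply: H; nra.
(* On the line, this radius means a parameter within (d - c) / 2 of the midpoint [m]. *)
have r0 : 0 < (d - c) / 2 * `|y - x| by rewrite mulr_gt0 ?normr_gt0 //; lra.
have [v [Dv]] := AD w Aw _ (nbhsx_ballx w _ r0).
rewrite -ball_normE /= distrC => vw.
have [k kE] := collinear v (DA v Dv).
move: vw; rewrite kE normrZ ltr_pM2r ?normr_gt0 // ltr_norml => /andP[k1 k2].
exists (m + k); last by rewrite /m; lra.
by rewrite scalerDl -kE addrA -/w addrC subrK.
Qed.

End dual_extra.

Theorem theorem3p4 (R : realType) (X : completeNormedModType R)
    (T : X -> set (dual X)) (D : set X)
    (lscT : lower_semicontinuous_op T)
    (convT : convex_set (domain T))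
    (DT : D `<=` domain T)
    (denseD : self_segment_dense D (domain T))
    (locT : locally_pseudomonotone T D)
    (neq0T : forall x y : X, domain T x -> domain T y -> x <> y ->
      forall z : X, (segment x y `&` (domain T `\` D)) z ->
      forall zs : dual X, T z zs -> pairing zs (y - x) <> 0) :
  pseudomonotone T.
Proof.
move=> x xs y ys /= Txs Tys.
have [->|/eqP xy] := eqVneq x y; first by rewrite subrr /pairing !linear0.
have Tx : domain T x by exists xs.
have Ty : domain T y by exists ys.
pose line t : X := x + t *: (y - x).
have line0 : line 0 = x by rewrite /line scale0r addr0.
have line1 : line 1 = y by rewrite /line scale1r addrC subrK.
have lineB u v : line v - line u = (v - u) *: (y - x).
  by rewrite /line opprD addrACA subrr add0r scalerBl.
have line_cont : continuous line.
  by move=> t; apply: cvgD; [exact: cvg_cst|apply: cvgZr_tmp; exact: cvg_id].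
have Tline t : 0 <= t <= 1 -> domain T (line t).
  exact: convex_set_line.
pose F t := [set pairing zs (y - x) | zs in T (line t)].
apply: (@lsc_local_sign_propagation R F (D \o line)).
- by move=> t /Tline[zs Tzs]; exists (pairing zs (y - x)), zs.
- move=> t t01 N oN [_ [[zs Tzs <-] Nzs]].
  have [|M nM HM] := lscT _ (Tline t t01)
    _ (open_pairing_preimage (y - x) N oN).
    by exists zs.
  near=> u => u01.
  have Mu : M (line u) by near: u; exact: line_cont nM.
  have [us [Tus Nus]] := HM (line u) (conj Mu (Tline u u01)).
  by exists (pairing us (y - x)); split => //; exists us.
- move=> c d c0 cd d1; apply: (@dense_in_convex_line _ _ (domain T)) => //.
  + exact: denseD.1.
  (* Any element of T(w) serves: [neq0T] is applied to the segment [w, u] with z its endpoint w. *)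
  + move=> w Tw nDw; have [ws Tws] := Tw; exists ws => u Tu uw.
    refine (neq0T w u Tw Tu (nesym uw) w _ ws Tws).
    split=> //; exists 0; first by rewrite /= in_itv /= lexx ler01.
    by rewrite scale0r addr0.
- move=> t t01 nDt [zs Tzs]; refine (neq0T x y Tx Ty xy (line t) _ zs Tzs).
  by split; [exists t; rewrite //= in_itv|split => //; exact: Tline].
- move=> t t01 Dt; have [U [oU Ut pmU]] := locT _ Dt.
  exists (line @^-1` U); first by apply: line_cont; exact: open_nbhs_nbhs.
  move=> u v _ _ Uu Uv Du Dv u0 uv v1 [us Tus <-] [vs Tvs <-].
  (* The factor v - u is positive, so pairing with [line v - line u] has the sign of pairing with y
     - x. *)
  have pairingE zs :
      pairing zs (line v - line u) = (v - u) * pairing zs (y - x).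
    by rewrite lineB /pairing linearZ.
  have := pmU (line u) us (line v) vs (conj (conj Uu Du) Tus)
    (conj (conj Uv Dv) Tvs).
  by rewrite !pairingE !pmulr_rge0 // subr_gt0.
- by exists xs => //; rewrite line0.
- by exists ys => //; rewrite line1.
Unshelve. all: by end_near.
Qed.
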